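(* Let $q$ be a prime power. If $\alpha\in\mathcal{R}_q$ is nonconstant, then $h(\alpha)\geq\frac{1}{q}$. If $\alpha\in\mathcal{R}_q^\times$ is nonconstant, then $h(\alpha)\geq\frac{1}{q-1}$. Both inequalities are sharp (for every $q$, each is attained with equality by some nonconstant element of $\mathcal{R}_q$, respectively $\mathcal{R}_q^\times$).
   Context: $\mathbb{F}_q(T)$ is the rational function field over the field with $q$ elements, $\overline{\mathbb{F}_q(T)}$ a fixed algebraic closure, and $\mathbb{F}_q((T))$ the field of formal Laurent series with its $T$-adic valuation $\mathrm{ord}_0$ (normalized by $\mathrm{ord}_0(T)=1$). The minimal polynomial of $\alpha\in\overline{\mathbb{F}_q(T)}$ is the unique polynomial $f\in\mathbb{F}_q[T][x]$ that is irreducible over $\mathbb{F}_q(T)$ as a polynomial in $x$, satisfies $f(\alpha)=0$, has coefficients in $\mathbb{F}_q[T]$ with no common factor, and whose leading coefficient (in $x$) is a monic polynomial in $T$. The height is $h(\alpha)=\deg_T(f)/\deg_x(f)$. An element $\alpha$ is totally $T$-adic if its minimal polynomial splits completely over $\mathbb{F}_q((T))$; $\mathcal{T}_q$ denotes the set of all totally $T$-adic elements of $\overline{\mathbb{F}_q(T)}$ (it is a field). The conjugates of $\alpha\in\mathcal{T}_q$ are the roots of its minimal polynomial in $\mathbb{F}_q((T))$. Define the ring $\mathcal{R}_q=\{\alpha\in\mathcal{T}_q : \mathrm{ord}_0(\beta)\geq 0\text{ for all conjugates }\beta\in\mathbb{F}_q((T))\text{ of }\alpha\}$, with unit group $\mathcal{R}_q^\times=\{\alpha\in\mathcal{T}_q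 : \mathrm{ord}_0(\beta)=0\text{ for all conjugates }\beta\in\mathbb{F}_q((T))\text{ of }\alpha\}$. An element is constant if it is algebraic over $\mathbb{F}_q$, and nonconstant otherwise. *)

(* Defs.v *)
From HB Require Import structures.
From mathcomp Require Import all_boot all_order all_algebra.
From mathcomp Require Import boolp classical_sets constructive_ereal.

Set Implicit Arguments.
Unset Strict Implicit.
Unset Printing Implicit Defensive.

Import Order.TTheory GRing.Theory Num.Theory.
Local Open Scope ring_scope.

(** * Formal power series F[[T]] *)

(* A record, rather than [nat -> F] itself, so that the pointwise product of
   functions cannot be picked up as the multiplication. *)
Record powser (F : fieldType) := Powser { coefs : nat -> F }.
Arguments Powser {F}.

Section PowerSeries.
Variable F : fieldType.
Implicit Types (a b c : powser F) (n : nat).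

HB.instance Definition _ := [isNew for @coefs F].
HB.instance Definition _ := [Choice of powser F by <:].

Lemma powserP a b : coefs a =1 coefs b <-> a = b.
Proof. by split=> [/funext e|-> //]; apply: val_inj. Qed.

Definition ps0 : powser F := Powser (fun=> 0).
Definition ps1 : powser F := Powser (fun n => (n == 0)%:R).
Definition ps_opp a := Powser (fun n => - coefs a n).
Definition ps_add a b := Powser (fun n => coefs a n + coefs b n).
Definition ps_mul a b :=
  Powser (fun n => \sum_(i < n.+1) coefs a i * coefs b (n - i)).

Fact ps_addA : associative ps_add.
Proof. by move=> a b c; apply/powserP => n /=; rewrite addrA. Qed.
Fact ps_addC : commutative ps_add.
Proof. by move=> a b; apply/powserP => n /=; rewrite addrC. Qed.
Fact ps_add0 : left_id ps0 ps_add.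
Proof. by move=> a; apply/powserP => n /=; rewrite add0r. Qed.
Fact ps_addN : left_inverse ps0 ps_opp ps_add.
Proof. by move=> a; apply/powserP => n /=; rewrite addNr. Qed.

HB.instance Definition _ :=
  GRing.isZmodule.Build (powser F) ps_addA ps_addC ps_add0 ps_addN.

Definition ps_trunc m a : {poly F} := \poly_(i < m) coefs a i.

Lemma coef_ps_mul m n a b : (n < m)%N ->
  coefs (ps_mul a b) n = (ps_trunc m a * ps_trunc m b)`_n.
Proof.
move=> ltnm; rewrite coefM /=; apply: eq_bigr => i _.
rewrite !coef_poly (leq_ltn_trans (leq_ord i) ltnm).
by rewrite (leq_ltn_trans (leq_subr i n) ltnm).
Qed.

Fact ps_mulC : commutative ps_mul.
Proof.
by move=> a b; apply/powserP => n; rewrite !(@coef_ps_mul n.+1) // mulrC.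
Qed.

Fact ps_mulA : associative ps_mul.
Proof.
move=> a b c; apply/powserP => n.
have E d e i : (i <= n)%N -> coefs (ps_mul d e) i =
    (ps_trunc n.+1 d * ps_trunc n.+1 e)`_i.
  by move=> lein; rewrite (@coef_ps_mul n.+1).
transitivity (ps_trunc n.+1 a * (ps_trunc n.+1 b * ps_trunc n.+1 c))`_n.
  rewrite coefM /=; apply: eq_bigr => i _.
  by rewrite -E ?leq_subr // coef_poly ltn_ord.
rewrite mulrA coefM /=; apply: eq_bigr => i _.
by rewrite -E ?leq_ord // coef_poly ltnS leq_subr.
Qed.

Fact ps_mul1 : left_id ps1 ps_mul.
Proof.
move=> a; apply/powserP => n /=.
rewrite big_ord_recl /= mul1r subn0 big1 ?addr0 // => i _.
by rewrite mul0r.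
Qed.

Fact ps_mulDl : left_distributive ps_mul ps_add.
Proof.
move=> a b c; apply/powserP => n /=; rewrite -big_split /=.
by apply: eq_bigr => i _; rewrite mulrDl.
Qed.

Fact ps_1neq0 : ps1 != 0 :> powser F.
Proof. by apply/eqP=> /powserP/(_ 0%N)/eqP; rewrite /= oner_eq0. Qed.

HB.instance Definition _ := GRing.Zmodule_isComNzRing.Build (powser F)
  ps_mulA ps_mulC ps_mul1 ps_mulDl ps_1neq0.

Lemma coefs0 n : coefs (0 : powser F) n = 0. Proof. by []. Qed.
Lemma coefs1 n : coefs (1 : powser F) n = (n == 0)%:R. Proof. by []. Qed.
Lemma coefsN a n : coefs (- a) n = - coefs a n. Proof. by []. Qed.
Lemma coefsD a b n : coefs (a + b) n = coefs a n + coefs b n.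
Proof. by []. Qed.
Lemma coefsM a b n :
  coefs (a * b) n = \sum_(i < n.+1) coefs a i * coefs b (n - i).
Proof. by []. Qed.


(* The first [n] coefficients of the inverse, computed by the usual recursion
   [b_0 = 1 / a_0] and [b_n = - (sum_(i < n) b_i * a_(n - i)) / a_0]. *)
Fixpoint ps_inv_seq a n : seq F :=
  if n is m.+1 then
    let s := ps_inv_seq a m in
    rcons s (((m == 0)%:R - \sum_(i < m) s`_i * coefs a (m - i)) / coefs a 0)
  else [::].

Definition ps_unit : {pred powser F} := fun a => coefs a 0 != 0.
Definition ps_inv a : powser F :=
  if ps_unit a then Powser (fun n => (ps_inv_seq a n.+1)`_n) else a.

Lemma size_ps_inv_seq a n : size (ps_inv_seq a n) = n.
Proof. by elim: n => //= n IHn; rewrite size_rcons IHn. Qed.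

Lemma nth_ps_inv_seq a m n : (n < m)%N ->
  (ps_inv_seq a m)`_n = (ps_inv_seq a n.+1)`_n.
Proof.
elim: m => // m IHm; rewrite ltnS leq_eqVlt => /predU1P[-> //|ltnm].
by rewrite [LHS]nth_rcons size_ps_inv_seq ltnm IHm.
Qed.

Fact ps_mulV : {in ps_unit, left_inverse 1 ps_inv *%R}.
Proof.
move=> a Ua; have a0 : coefs a 0 != 0 by [].
apply/powserP => n; rewrite coefsM /ps_inv ifT //= big_ord_recr /= subnn.
rewrite nth_rcons size_ps_inv_seq ltnn eqxx divfK //.
rewrite addrCA -[RHS]addr0; congr (_ + _).
apply/eqP; rewrite subr_eq0; apply/eqP; apply: eq_bigr => i _.
by rewrite [in RHS]nth_ps_inv_seq.
Qed.

Fact ps_unitPl a b : b * a = 1 -> ps_unit a.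
Proof.
move=> /powserP/(_ 0%N); rewrite coefsM big_ord1 /= => ba1.
by apply: contra_eq_neq ba1 => /= ->; rewrite mulr0 eq_sym oner_neq0.
Qed.

Fact ps_inv_out : {in [predC ps_unit], ps_inv =1 id}.
Proof. by move=> a Ua; rewrite /ps_inv ifN. Qed.

HB.instance Definition _ := GRing.ComNzRing_hasMulInverse.Build (powser F)
  ps_mulV ps_unitPl ps_inv_out.

(* The order of vanishing at T = 0, with the junk value 0 on the zero series. *)
Definition ps_ord a : nat :=
  if pselect (exists n, coefs a n != 0) is left e then ex_minn e else 0.

Lemma ps_neq0 a : a != 0 <-> exists n, coefs a n != 0.
Proof.
split=> [|[n an]]; last by apply: contraNneq an => ->.
apply: contraPP => /forallNP a0; apply/negP; rewrite negbK; apply/eqP.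
by apply/powserP => n; apply/eqP/negPn/negP/a0.
Qed.

Lemma ps_ordP a n :
  coefs a n != 0 -> (forall i, (i < n)%N -> coefs a i = 0) -> ps_ord a = n.
Proof.
move=> an a0; rewrite /ps_ord; case: pselect => [e|[]]; last by exists n.
case: ex_minnP => m am /(_ n an) lemn; apply/eqP; rewrite eqn_leq lemn /=.
by rewrite leqNgt; apply: contraNN am => /a0->.
Qed.

Lemma coefs_ps_ord a : a != 0 -> coefs a (ps_ord a) != 0.
Proof.
by move/ps_neq0 => e; rewrite /ps_ord; case: pselect => // ?; case: ex_minnP.
Qed.

Lemma coefs_lt_ord a n : (n < ps_ord a)%N -> coefs a n = 0.
Proof.
rewrite /ps_ord; case: pselect => // ?; case: ex_minnP => m _ H ltnm.
by apply/eqP; apply: contraTT ltnm => /H; rewrite -leqNgt.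
Qed.

Lemma ps_mul_ord a b : a != 0 -> b != 0 ->
  coefs (a * b) (ps_ord a + ps_ord b) =
    coefs a (ps_ord a) * coefs b (ps_ord b).
Proof.
move=> a0 b0; rewrite coefsM.
have lt_k : (ps_ord a < (ps_ord a + ps_ord b).+1)%N by rewrite ltnS leq_addr.
rewrite (bigD1 (Ordinal lt_k)) //= addKn big1 ?addr0 // => i neq.
have [lti|lti|eqi] := ltngtP i (ps_ord a).
- by rewrite coefs_lt_ord ?mul0r.
- rewrite (@coefs_lt_ord b) ?mulr0 //.
  by rewrite -(ltn_add2r i) subnK ?leq_ord // [ltnRHS]addnC ltn_add2r.
- by case/eqP: neq; apply: val_inj.
Qed.

Fact ps_idom a b : a * b = 0 -> (a == 0) || (b == 0).
Proof.
move=> ab0; apply/norP => -[a0 b0].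
have /eqP := ps_mul_ord a0 b0; rewrite ab0 coefs0 eq_sym mulf_eq0.
by rewrite (negbTE (coefs_ps_ord a0)) (negbTE (coefs_ps_ord b0)).
Qed.

HB.instance Definition _ :=
  GRing.ComUnitRing_isIntegral.Build (powser F) ps_idom.

Lemma ps_ordM a b : a != 0 -> b != 0 ->
  ps_ord (a * b) = (ps_ord a + ps_ord b)%N.
Proof.
move=> a0 b0; apply: ps_ordP => [|n ltn].
  by rewrite ps_mul_ord // mulf_neq0 ?coefs_ps_ord.
rewrite coefsM big1 // => i _.
have [lti|lei] := ltnP i (ps_ord a); first by rewrite coefs_lt_ord ?mul0r.
rewrite (@coefs_lt_ord b) ?mulr0 // -(ltn_add2r i) subnK ?leq_ord //.
by rewrite (leq_trans ltn) // [leqRHS]addnC leq_add2r.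
Qed.

Definition ps_of_poly (p : {poly F}) : powser F := Powser (fun n => p`_n).

Fact ps_of_poly_is_zmod_morphism : zmod_morphism ps_of_poly.
Proof. by move=> p r; apply/powserP => n /=; rewrite coefB. Qed.
Fact ps_of_poly_is_monoid_morphism : monoid_morphism ps_of_poly.
Proof.
by split=> [|p r]; apply/powserP => n /=; rewrite ?coef1 // coefM.
Qed.
HB.instance Definition _ := GRing.isZmodMorphism.Build {poly F} (powser F)
  ps_of_poly ps_of_poly_is_zmod_morphism.
HB.instance Definition _ := GRing.isMonoidMorphism.Build {poly F} (powser F)
  ps_of_poly ps_of_poly_is_monoid_morphism.

End PowerSeries.

(** * The field F((T)) of formal Laurent series *)

Notation laurent F := {fraction powser F}.

Lemma tofrac_num (R : idomainType) (x : {fraction R}) :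
  FracField.tofrac \n_(repr x) = x * FracField.tofrac \d_(repr x).
Proof.
have {2}-> : x = \pi_{fraction R}%qT (repr x) by rewrite reprK.
unlock FracField.tofrac; rewrite -[RHS]FracField.pi_mul.
apply/eqmodP; rewrite /= FracField.equivfE /FracField.mulf.
by rewrite !numden_Ratio ?oner_neq0 ?mulr1 ?mul1r ?denom_ratioP //.
Qed.

Lemma fracP (R : idomainType) (x : {fraction R}) :
  x = FracField.tofrac \n_(repr x) / FracField.tofrac \d_(repr x).
Proof. by rewrite tofrac_num mulfK ?tofrac_eq0 ?denom_ratioP. Qed.

Section Laurent.
Variable F : fieldType.

Definition laurent_of_poly (p : {poly F}) : laurent F :=
  FracField.tofrac (ps_of_poly p).
HB.instance Definition _ :=
  GRing.RMorphism.copy laurent_of_poly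
    (@FracField.tofrac (powser F) \o @ps_of_poly F).

(* Independent of the representative of the fraction: see [ord0_frac]. *)
Definition ord0_laurent (x : laurent F) : \bar int :=
  if x == 0 then +oo%E
  else ((ps_ord \n_(repr x))%:Z - (ps_ord \d_(repr x))%:Z)%:E.

Lemma ord0_frac (a b : powser F) : a != 0 -> b != 0 ->
  ord0_laurent (FracField.tofrac a / FracField.tofrac b) =
    ((ps_ord a)%:Z - (ps_ord b)%:Z)%:E.
Proof.
move=> a0 b0; set x := _ / _.
have x0 : x != 0 by rewrite mulf_neq0 ?invr_eq0 ?tofrac_eq0.
rewrite /ord0_laurent (negbTE x0); congr (_%:E).
have d0 := denom_ratioP (repr x).
have n0 : \n_(repr x) != 0.
  apply: contraNneq x0 => n0.
  by rewrite (fracP x) n0 rmorph0 mul0r.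
have /eqP := fracP x; rewrite {1}/x eqr_div ?tofrac_eq0 // -!rmorphM tofrac_eq.
move=> /eqP/(congr1 (@ps_ord F)); rewrite !ps_ordM // => /(congr1 Posz).
rewrite !PoszD => e; apply/eqP.
by rewrite subr_eq addrAC eq_sym subr_eq e eqxx.
Qed.

Lemma ord0_X : ord0_laurent (laurent_of_poly 'X) = 1%:E.
Proof.
have X0 : ps_of_poly 'X != 0 :> powser F.
  by apply/ps_neq0; exists 1%N; rewrite /= coefX oner_neq0.
have := ord0_frac X0 (oner_neq0 (powser F)).
rewrite rmorph1 divr1 => ->; congr (_%:E).
rewrite (@ps_ordP _ _ 1%N) /=; last 2 first.
- by rewrite coefX oner_neq0.
- by case=> // _; rewrite coefX.
rewrite (@ps_ordP _ 1 0%N) ?subr0 //.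
by rewrite coefs1 oner_neq0.
Qed.
End Laurent.

(** * Algebraic functions over F *)

Notation ratfun F := {fraction {poly F}}.

Section Minpoly.
Variables (F : fieldType) (L : closedFieldType).
Variable iota : {rmorphism ratfun F -> L}.
Implicit Types (alpha : L) (f : {poly {poly F}}).

(* [{poly {poly F}}] is F[T][x]: the outer variable is x, the inner one T. *)
Definition is_minpoly alpha f : Prop :=
  [/\ irreducible_poly (map_poly (@FracField.tofrac {poly F}) f),
      root (map_poly (iota \o @FracField.tofrac {poly F}) f) alpha,
      forall d : {poly F}, (forall i, d %| f`_i) -> d %= 1
    & lead_coef f \is monic].

Local Open Scope classical_set_scope.

(* The default value 0 is never taken when alpha is algebraic, and the choice
   is then unique: see [minpolyP] and [is_minpoly_uniq] below. *)
Definition minpoly alpha : {poly {poly F}} :=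
  xget 0 [set f | is_minpoly alpha f].

(* deg_T f / deg_x f, with [sizeY] one more than the degree in the inner
   variable. *)
Definition height alpha : rat :=
  (sizeY (minpoly alpha)).-1%:R / (size (minpoly alpha)).-1%:R.

Definition is_constant alpha : Prop :=
  algebraicOver (iota \o @FracField.tofrac {poly F} \o @polyC F) alpha.

Definition minpoly_laurent alpha : {poly laurent F} :=
  map_poly (@laurent_of_poly F) (minpoly alpha).

Definition totally_Tadic : set L :=
  [set alpha | exists s : seq (laurent F),
     minpoly_laurent alpha =
       lead_coef (minpoly_laurent alpha) *: \prod_(b <- s) ('X - b%:P)].

Definition conjugates alpha : set (laurent F) :=
  [set b | root (minpoly_laurent alpha) b].

Definition calR : set L :=
  [set alpha | totally_Tadic alpha /\
     forall b, conjugates alpha b -> (0%:E <= ord0_laurent b)%E].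

Definition calR_units : set L :=
  [set alpha | totally_Tadic alpha /\
     forall b, conjugates alpha b -> ord0_laurent b = 0%:E].

Local Notation tofracp := (map_poly (@FracField.tofrac {poly F})).

Lemma clear_denom (p : {poly ratfun F}) :
  exists d f, d != 0 /\ FracField.tofrac d *: p = tofracp f.
Proof.
elim/poly_ind: p => [|p c [d [f [d0 e]]]].
  by exists 1, 0; rewrite oner_neq0 scaler0 rmorph0.
set n := \n_(repr c); set m := \d_(repr c).
have m0 : m != 0 by exact: denom_ratioP.
exists (d * m), (m *: f * 'X + (d * n)%:P); split; first exact: mulf_neq0.
rewrite scalerDr rmorphD /= [X in _ = X + _]rmorphM /= map_polyX map_polyC.
rewrite map_polyZ /= -e scalerA -scalerAl; congr (_ *: _ + _).
  by rewrite rmorphM mulrC.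
rewrite -mul_polyC -polyCM; congr _%:P.
rewrite [X in _ * X = _](fracP c) -/n -/m !rmorphM /= -mulrA [X in _ * X]mulrC.
by rewrite divfK ?tofrac_eq0.
Qed.

Lemma tofracp_inj : injective tofracp.
Proof.
apply: map_inj_poly; last exact: rmorph0.
by move=> x y /eqP; rewrite tofrac_eq => /eqP.
Qed.

Lemma irreducible_root_eqp (p r : {poly ratfun F}) alpha :
  irreducible_poly p -> irreducible_poly r ->
  root (map_poly iota p) alpha -> root (map_poly iota r) alpha -> p %= r.
Proof.
move=> [sp ip] [sr ir] rp rr.
have g1 : size (gcdp p r) != 1.
  apply/negP => g1; have : coprimep (map_poly iota p) (map_poly iota r).
    by rewrite coprimep_map.
  by move/coprimep_root/(_ rp)/negP; apply.
by rewrite (eqp_trans _ (ir _ g1 (dvdp_gcdr p r))) // eqp_sym ip ?dvdp_gcdl.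
Qed.

Lemma is_minpoly_uniq alpha f1 f2 :
  is_minpoly alpha f1 -> is_minpoly alpha f2 -> f1 = f2.
Proof.
move=> [i1 r1 c1 m1] [i2 r2 c2 m2].
have rE f : map_poly (iota \o @FracField.tofrac {poly F}) f =
  map_poly iota (tofracp f) by rewrite map_poly_comp.
rewrite !rE in r1 r2.
have /eqpP[[x y] /= /andP[x0 y0] e] := irreducible_root_eqp i1 i2 r1 r2.
have [a [b [a0 b0 eab]]] : exists a b, [/\ a != 0, b != 0 & a *: f1 = b *: f2].
  exists (\n_(repr x) * \d_(repr y)), (\n_(repr y) * \d_(repr x)).
  have dx := denom_ratioP (repr x); have dy := denom_ratioP (repr y).
  have nx : \n_(repr x) != 0.
    by apply: contraNneq x0 => n0; rewrite (fracP x) n0 rmorph0 mul0r.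
  have ny : \n_(repr y) != 0.
    by apply: contraNneq y0 => n0; rewrite (fracP y) n0 rmorph0 mul0r.
  split; [exact: mulf_neq0 | exact: mulf_neq0 |].
  apply: tofracp_inj; rewrite !map_polyZ /= !rmorphM /=.
  set X := FracField.tofrac \d_(repr x); set Y := FracField.tofrac \d_(repr y).
  have X0 : X != 0 by rewrite tofrac_eq0.
  have Y0 : Y != 0 by rewrite tofrac_eq0.
  rewrite !tofrac_num -/X -/Y.
  by rewrite -mulrA mulrC -scalerA e scalerA mulrC mulrAC mulrA.
pose g := gcdp a b.
have g0 : g != 0 by rewrite gcdp_eq0 negb_and a0.
have ea : a = a %/ g * g by rewrite divpK ?dvdp_gcdl.
have eb : b = b %/ g * g by rewrite divpK ?dvdp_gcdr.
have cop : coprimep (a %/ g) (b %/ g) by rewrite coprimep_div_gcd ?a0.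
have e' i : (a %/ g) * f1`_i = (b %/ g) * f2`_i.
  have := congr1 (fun p : {poly {poly F}} => p`_i) eab; rewrite !coefZ.
  by rewrite {1}ea {1}eb ![_ * g * _]mulrAC => /(mulIf g0).
have ua : a %/ g %= 1.
  by apply: c2 => i; rewrite -(Gauss_dvdpr _ cop) -e' dvdp_mulr.
have ub : b %/ g %= 1.
  apply: c1 => i; rewrite -(@Gauss_dvdpr _ _ (a %/ g)) 1?coprimep_sym //.
  by rewrite e' dvdp_mulr.
have {}ua : size (a %/ g) == 1 by rewrite size_poly_eq1.
have {}ub : size (b %/ g) == 1 by rewrite size_poly_eq1.
have [u u0 eu] := size_poly1P _ ua; have [v v0 ev] := size_poly1P _ ub.
have ef : u%:P *: f1 = v%:P *: f2.
  by apply/polyP => i; rewrite !coefZ -eu -ev.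
have : u = v.
  have := congr1 (@lead_coef F \o @lead_coef {poly F}) ef.
  rewrite /= !lead_coefZ !lead_coefM !lead_coefC.
  by rewrite (monicP m1) (monicP m2) !mulr1.
move=> uv; have u0' : u%:P != 0 :> {poly F} by rewrite polyC_eq0.
apply/polyP => i; apply: (mulfI u0').
by have := congr1 (fun p : {poly {poly F}} => p`_i) ef; rewrite !coefZ uv.
Qed.

Lemma is_minpoly_exists alpha :
  algebraicOver iota alpha -> exists f, is_minpoly alpha f.
Proof.
move=> [p0 p00 rp0].
pose P n := `[< exists p,
  [/\ p != 0, root (map_poly iota p) alpha & size p = n] >].
have exP : exists n, P n by exists (size p0); apply/asboolP; exists p0.
case: (ex_minnP exP) => n /asboolP[p [p_0 rp sp]] minp.
have irrp : irreducible_poly p.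
  split=> [|r /eqP sr rdvd].
    rewrite ltnNge; apply: contraL rp => /size1_polyC ep.
    rewrite ep map_polyC /= rootC fmorph_eq0.
    by apply: contraNneq p_0 => c0; rewrite ep c0.
  have ep : p = p %/ r * r by rewrite divpK.
  have /andP[h0 r0] : (p %/ r != 0) && (r != 0).
    by rewrite -negb_or -mulf_eq0 -ep.
  have lesz s : s != 0 -> root (map_poly iota s) alpha -> (size p <= size s)%N.
    by move=> s0 rs; rewrite sp; apply: minp; apply/asboolP; exists s.
  move: rp; rewrite {1}ep rmorphM /= rootM => /orP[/lesz|/lesz]; last first.
    move=> /(_ r0) le; rewrite -dvdp_size_eqp // eqn_leq le.
    by rewrite dvdp_leq.
  move=> /(_ h0); rewrite {1}ep size_mul // => le.
  have szr : (0 < size r)%N by rewrite size_poly_gt0.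
  case: sr; rewrite -(prednK szr); congr _.+1; apply/eqP.
  move: le; rewrite -{1}(prednK szr) addnS /= -[leqRHS]addn0 leq_add2l.
  by rewrite leqn0.
pose Q n := `[< exists f,
  [/\ f != 0, tofracp f %= p & size (lead_coef f) = n] >].
have exQ : exists n, Q n.
  have [d [f [d0 e]]] := clear_denom p.
  exists (size (lead_coef f)); apply/asboolP; exists f; split=> //.
    have : tofracp f != 0 by rewrite -e scaler_eq0 tofrac_eq0 negb_or d0.
    by apply: contraNneq => ->; rewrite rmorph0.
  by rewrite -e eqp_scale // tofrac_eq0.
case: (ex_minnP exQ) => m /asboolP[f [f0 fp sf]] minf.
have primf (d : {poly F}) : (forall i, d %| f`_i) -> d %= 1.
  move=> dvd; pose f' : {poly {poly F}} := \poly_(i < size f) (f`_i %/ d).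
  have ef : f = d *: f'.
    apply/polyP => i; rewrite coefZ coef_poly; case: ltnP => [_|le].
      by rewrite mulrC divpK.
    by rewrite nth_default // mulr0.
  have d0 : d != 0 by apply: contraNneq f0 => d0; rewrite ef d0 scale0r.
  have f'0 : f' != 0 by apply: contraNneq f0 => f'0; rewrite ef f'0 scaler0.
  have : Q (size (lead_coef f')).
    apply/asboolP; exists f'; split=> //; apply: eqp_trans fp.
    by rewrite ef map_polyZ /= eqp_sym eqp_scale // tofrac_eq0.
  move=> /minf; rewrite -sf {1}ef lead_coefZ size_mul ?lead_coef_eq0 //.
  have sd : (0 < size d)%N by rewrite size_poly_gt0.
  rewrite -size_poly_eq1 eqn_leq sd andbT -[size d]prednK // addSn /=.
  by rewrite -{2}[size (lead_coef f')]add0n leq_add2r.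
have c0 : lead_coef (lead_coef f) != 0 by rewrite !lead_coef_eq0.
pose c := (lead_coef (lead_coef f))^-1.
have cN0 : c != 0 by rewrite invr_eq0.
have cP0 : c%:P != 0 :> {poly F} by rewrite polyC_eq0.
have eqf : tofracp (c%:P *: f) %= p.
  by apply: eqp_trans fp; rewrite map_polyZ eqp_scale // tofrac_eq0.
exists (c%:P *: f); split.
- have [s i] := irrp; split; first by rewrite (eqp_size eqf).
  move=> r sr; rewrite (eqp_dvdr _ eqf) => /(i _ sr) rp'.
  by rewrite (eqp_trans rp') // eqp_sym.
- rewrite map_poly_comp /= (eqp_root (_ : _ %= map_poly iota p)) //.
  by rewrite eqp_map.
- move=> d dvd; apply: primf => i; have := dvd i.
  by rewrite coefZ mul_polyC dvdpZr.
- by rewrite monicE lead_coefZ lead_coefM lead_coefC mulVf.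
Qed.

Lemma minpolyP alpha :
  algebraicOver iota alpha -> is_minpoly alpha (minpoly alpha).
Proof. by move=> /is_minpoly_exists; apply: xgetPex. Qed.

End Minpoly.

(* Main.v *)
From HB Require Import structures.
Require Import Defs.
From mathcomp Require Import all_boot all_order all_algebra.
From mathcomp Require Import separable finfield ring.
From mathcomp Require Import boolp classical_sets constructive_ereal.
Import Order.TTheory GRing.Theory Num.Theory.
Local Open Scope ring_scope.

(** Write [T] for the inner variable and let [f] be the minimal polynomial of
    a nonconstant [alpha] in the ring R_q, of degree [d] in [x] and [h] in [T].

    Lower bounds.  The conjugates of [alpha] are power series [b_1 .. b_d]
    ([calR_split]), and each has a residue [b_i(0)] in F_q.  For [a] in F_q the
    polynomial [f(a)] in F_q[T] is nonzero, since otherwise [alpha = a] would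
    be constant, and over F_q[[T]] it is a multiple of [prod_i (a - b_i)], so
    it vanishes at [T = 0] to order at least the number of [i] with
    [b_i(0) = a].  Its degree is at most [h], so every residue class contains
    at most [h] conjugates
    ([count_residue_le]).  There are [q] classes, and [q - 1] when all [b_i]
    are units; hence [d <= q h], resp. [d <= (q - 1) h] ([height_ge]).

    Sharpness.  Equality forces every residue to occur equally often.  The
    simplest way is [h = 1] and each allowed residue once, which is achieved by
    [f = A(x) - T] with [A] the product of the [x - a], [a] ranging over F_q,
    resp. over its nonzero elements ([height_attained]).  Modulo [T] this
    polynomial has simple roots in F_q, so it splits over F_q[[T]] by Hensel's
    lemma ([hensel_split]).  It is the minimal polynomial of each of its roots
    [alpha] because [T = A(alpha)] forces [alpha] to be transcendental over
    F_q: a polynomial [g(T, x)] killed by [alpha] satisfies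
    [g(A(alpha), alpha) = 0], hence [g(A(x), x) = 0], hence [T - A(x)] divides
    it in F_q[x][T] ([graph_dvd]). *)

Local Notation tofrac := (@FracField.tofrac _).

(** * Power series: residues and Hensel's lemma *)

Lemma tofrac_inj (R : idomainType) : injective (@FracField.tofrac R).
Proof. by move=> x y /eqP; rewrite tofrac_eq => /eqP. Qed.

(** Both sides set the inner variable to [a]; the outer value [B] is then only
    seen through [B.[a]].  This puts an evaluation along a curve in the form
    that [horner2_swapXY] handles. *)
Lemma horner2_outer {R : comNzRingType} (P : {poly {poly R}}) (B : {poly R})
    (a : R) :
  P.[B].[a] = P.[(B.[a])%:P].[a].
Proof.
rewrite -[LHS]/(horner_eval a _) -[RHS]/(horner_eval a _).
by rewrite -[LHS]horner_map -[RHS]horner_map /= /horner_eval hornerC.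
Qed.

Definition ps_res {F : fieldType} (a : powser F) : F := coefs a 0.
Arguments ps_res {F} a : simpl never.

Section PowerSeries.
Context {F : fieldType}.
Implicit Types (a b : powser F) (x : F) (m n : nat).


Fact ps_res_is_zmod_morphism : zmod_morphism (@ps_res F).
Proof. by []. Qed.
Fact ps_res_is_monoid_morphism : monoid_morphism (@ps_res F).
Proof. by split=> // a b; rewrite /ps_res coefsM big_ord1. Qed.
HB.instance Definition _ := GRing.isZmodMorphism.Build (powser F) F
  (@ps_res F) ps_res_is_zmod_morphism.
HB.instance Definition _ := GRing.isMonoidMorphism.Build (powser F) F
  (@ps_res F) ps_res_is_monoid_morphism.

Definition ps_const x : powser F := ps_of_poly x%:P.

Lemma ps_res_const x : ps_res (ps_const x) = x.
Proof. by rewrite /ps_res /= coefC. Qed.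

(** Membership in the ideal generated by [T ^ n], by coefficients so that the
    limit of a sequence can be handled coefficient by coefficient. *)
Definition ps_small n a := forall i, (i < n)%N -> coefs a i = 0.

Lemma ps_small1 a : ps_res a = 0 -> ps_small 1 a.
Proof. by move=> a0 [|i]. Qed.

Lemma ps_smallW {m n a} : (m <= n)%N -> ps_small n a -> ps_small m a.
Proof. by move=> lemn sa i ltim; apply: sa; apply: leq_trans lemn. Qed.

Lemma ps_smallD {n a b} : ps_small n a -> ps_small n b -> ps_small n (a + b).
Proof. by move=> sa sb i lti; rewrite coefsD sa ?sb ?addr0. Qed.

Lemma ps_smallN {n a} : ps_small n a -> ps_small n (- a).
Proof. by move=> sa i lti; rewrite coefsN sa ?oppr0. Qed.

Lemma ps_smallM {m n a b} :
  ps_small m a -> ps_small n b -> ps_small (m + n) (a * b).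
Proof.
move=> sa sb i lti; rewrite coefsM big1 // => j _.
have [ltjm|lemj] := ltnP j m; first by rewrite sa ?mul0r.
by rewrite sb ?mulr0 // ltn_subLR ?leq_ord // (leq_trans lti) // leq_add2r.
Qed.

Lemma ps_smallMl {n a} b : ps_small n a -> ps_small n (a * b).
Proof. by move=> sa; rewrite -[n]addn0; apply: ps_smallM. Qed.

Lemma ps_small_eq0 a : (forall n, ps_small n a) -> a = 0.
Proof. by move=> sa; apply/powserP => n; apply: (sa n.+1). Qed.

Lemma horner_taylor2 {R : comNzRingType} (p : {poly R}) (x h : R) :
  exists e, p.[x + h] = p.[x] + p^`().[x] * h + e * h ^+ 2.
Proof.
elim/poly_ind: p => [|p c [e IHp]].
  by exists 0; rewrite deriv0 !horner0 !mul0r !addr0.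
exists (e * (x + h) + p^`().[x]).
by rewrite derivMXaddC !hornerMXaddC hornerD hornerMX IHp; ring.
Qed.

(** Newton iteration with the constant slope [d = f'(x)] taken modulo [T]: the
    map [b |-> b - f(b) / d] preserves the residue [x] and gains one order of
    [T]-adic precision at each step, since its derivative [1 - f'(b) / d]
    vanishes modulo [T].  Its limit is a fixed point, that is, a root. *)
Lemma hensel (f : {poly powser F}) (x : F) :
    root (map_poly ps_res f) x -> ~~ root (map_poly ps_res f)^`() x ->
  exists2 b, root f b & ps_res b = x.
Proof.
rewrite deriv_map /root => /eqP fx0.
set d := (map_poly ps_res f^`()).[x] => d0.
have res_horner (p : {poly powser F}) b :
    ps_res p.[b] = (map_poly ps_res p).[ps_res b] by rewrite horner_map.
pose newton b : powser F := b - f.[b] * ps_const d^-1.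
have newton_contract n b h : ps_res b = x -> ps_small n.+1 h ->
    ps_small n.+2 (newton (b + h) - newton b).
  move=> bx sh; have [e fbh] := horner_taylor2 f b h.
  have -> : newton (b + h) - newton b =
      h * (1 - f^`().[b] * ps_const d^-1 - e * ps_const d^-1 * h).
    by rewrite /newton fbh; ring.
  rewrite -[n.+2]addn1; apply: ps_smallM => //.
  apply: ps_small1; rewrite !(rmorphB, rmorphM) rmorph1 /= res_horner bx -/d.
  by rewrite ps_res_const divff // subrr [ps_res h]sh // mulr0 subr0.
have newton_res b : ps_res b = x -> ps_res (newton b) = x.
  by move=> bx; rewrite rmorphB rmorphM /= res_horner bx fx0 mul0r subr0.
pose s k := iter k newton (ps_const x).
have s_res k : ps_res (s k) = x.
  by elim: k => [|k IHk]; [exact: ps_res_const | exact: newton_res].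
have s_step k : ps_small k.+1 (s k.+1 - s k).
  elim: k => [|k IHk].
    apply: ps_small1; transitivity (ps_res (s 1) - ps_res (s 0)).
      exact: rmorphB.
    by rewrite !s_res subrr.
  have -> : s k.+2 = newton (s k + (s k.+1 - s k)) by rewrite addrC subrK.
  exact: newton_contract.
have s_stable k i : (i <= k)%N -> coefs (s k) i = coefs (s i) i.
  elim: k => [|k IHk]; first by rewrite leqn0 => /eqP ->.
  rewrite leq_eqVlt => /predU1P[-> //|ltik].
  rewrite -IHk //; apply/eqP; rewrite -subr_eq0; apply/eqP.
  exact: s_step.
(* Coefficient [n] is stationary from step [n] on, so the diagonal is the
   limit of the iteration. *)
pose b := Powser (fun n => coefs (s n) n).
have s_lim k : ps_small k.+1 (b - s k).
  by move=> i leik; rewrite coefsD coefsN /= s_stable ?subrr.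
have bx : ps_res b = x by rewrite -(s_res 0).
exists b => //.
have /eqP : newton b - b = 0.
  apply: ps_small_eq0 => k; apply: (@ps_smallW _ k.+2); first exact: leqW.
  have -> : newton b - b =
      (newton (s k + (b - s k)) - newton (s k)) - (b - s k.+1).
    by rewrite [s k + _]addrC subrK /=; ring.
  by apply: ps_smallD; [exact: newton_contract | exact/ps_smallN].
rewrite /newton addrAC subrr add0r oppr_eq0 mulf_eq0 => /orP[] // /eqP.
move=> /(congr1 ps_res)/eqP; rewrite ps_res_const rmorph0 invr_eq0.
by rewrite (negbTE d0).
Qed.

(** The residues are simple roots of the reduction, so each lifts.  Lifts of
    distinct residues differ by units, which is what makes the corresponding
    linear factors divide [f] simultaneously. *)
Lemma hensel_split (f : {poly powser F}) (s : seq F) :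
    f \is monic -> map_poly ps_res f = \prod_(x <- s) ('X - x%:P) -> uniq s ->
  exists2 t, f = \prod_(b <- t) ('X - b%:P) & map ps_res t = s.
Proof.
move=> monf fs us.
have lift x : x \in s -> exists2 b, root f b & ps_res b = x.
  move=> xs; apply: hensel; rewrite fs ?root_prod_XsubC //.
  have := us; rewrite -separable_prod_XsubC separable_poly.unlock.
  by move/coprimep_root; apply; rewrite root_prod_XsubC.
have [t rt ts] : exists2 t, all (root f) t & map ps_res t = s.
  have : {subset s <= s} by [].
  elim: {1 3}s => [|x r IHr] sub; first by exists [::].
  have [b rb bx] := lift x (sub x (mem_head x r)).
  have [y yr|t rt tr] := IHr; first by apply: sub; rewrite inE yr orbT.
  by exists (b :: t); rewrite /= ?rb // bx tr.
exists t => //.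
have sf : size f = (size t).+1.
  rewrite -(size_map ps_res t) ts -(size_prod_XsubC s id) -fs.
  rewrite -(size_map_poly_id0 (f := ps_res)) //.
  by rewrite (monicP monf) rmorph1 oner_neq0.
have -> : f = lead_coef f *: \prod_(b <- t) ('X - b%:P).
  apply: all_roots_prod_XsubC => //.
  move: us; rewrite -ts; elim: (t) => //= b r IHr /andP[br /IHr ->].
  rewrite andbT; apply/allP => c cr; rewrite /diff_roots mulrC eqxx /=.
  (* Invertibility in [powser F] is non-vanishing of the constant term. *)
  change (ps_res (c - b) != 0); rewrite rmorphB subr_eq0.
  by apply: contraNneq br => <-; apply: map_f.
by rewrite (monicP monf) scale1r.
Qed.
End PowerSeries.

(** * Integral Laurent series *)

Section Laurent.
Context {F : fieldType}.
Implicit Types (a b : powser F) (x : laurent F).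

Definition ps_shift k a : powser F := Powser (fun n => coefs a (n + k)).

Lemma ps_shiftK k a : ps_small k a -> a = ps_of_poly 'X^k * ps_shift k a.
Proof.
move=> sa; apply/powserP => n; rewrite coefsM /=.
have [ltnk|lekn] := ltnP n k.
  rewrite sa // big1 // => i _; rewrite coefXn.
  by rewrite ltn_eqF ?mul0r // (leq_ltn_trans _ ltnk) // -ltnS.
rewrite (bigD1 (Ordinal (lekn : (k < n.+1)%N))) //= coefXn eqxx mul1r subnK //.
rewrite big1 ?addr0 // => i neik; rewrite coefXn.
rewrite (_ : _ == _ = false) ?mul0r //; apply: contraNF neik => /eqP e.
exact/eqP/val_inj.
Qed.

Lemma ord0_tofrac b : b != 0 -> ord0_laurent (tofrac b) = (ps_ord b)%:Z%:E.
Proof.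
move=> b0; have := ord0_frac b0 (oner_neq0 (powser F)).
rewrite rmorph1 divr1 => ->; rewrite (@ps_ordP _ 1 0%N) ?subr0 //.
by rewrite coefs1 oner_neq0.
Qed.

Lemma ord0_tofrac_ge0 b : (0%:E <= ord0_laurent (tofrac b))%E.
Proof.
have [->|/ord0_tofrac->] := eqVneq b 0; last by rewrite lee_fin.
by rewrite rmorph0 /ord0_laurent eqxx leey.
Qed.

Lemma ord0_tofrac_eq0 b : ord0_laurent (tofrac b) = 0%:E <-> ps_res b != 0.
Proof.
have [->|b0] := eqVneq b 0.
  by rewrite rmorph0 /ord0_laurent eqxx [ps_res 0]rmorph0 eqxx.
rewrite ord0_tofrac //; split=> [[ob]|b00].
  by have := coefs_ps_ord b0; rewrite ob.
by rewrite (@ps_ordP _ _ 0%N).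
Qed.

(** In a quotient [n / d] with [ord n >= ord d = k], cancelling [T ^ k] leaves
    a denominator with nonzero constant term, a unit of F[[T]]. *)
Lemma ord0_ge0 x : (0%:E <= ord0_laurent x)%E -> exists b, x = tofrac b.
Proof.
have [-> _|x0] := eqVneq x 0; first by exists 0; rewrite rmorph0.
rewrite /ord0_laurent (negbTE x0) lee_fin subr_ge0 lez_nat.
set n := \n_(repr x); set d := \d_(repr x); set k := ps_ord d => lek.
have d0 : d != 0 by exact: denom_ratioP.
have nE : n = ps_of_poly 'X^k * ps_shift k n.
  by apply: ps_shiftK => i lti; apply/coefs_lt_ord/(leq_trans lti).
have dE : d = ps_of_poly 'X^k * ps_shift k d.
  by apply: ps_shiftK => i; apply: coefs_lt_ord.
have ud : ps_shift k d \is a GRing.unit by exact: (coefs_ps_ord d0).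
exists (ps_shift k n / ps_shift k d); rewrite [LHS]fracP -/n -/d.
apply: (canLR (mulfK _)); first by rewrite tofrac_eq0.
rewrite -rmorphM; congr tofrac.
by rewrite [LHS]nE [X in _ = _ * X]dE mulrCA divrK.
Qed.
End Laurent.

(** * The lower bounds *)

Lemma ps_small_prod {F : fieldType} (t : seq (powser F)) (x : F) :
  ps_small (count (fun b => ps_res b == x) t)
           (\prod_(b <- t) (ps_const x - b)).
Proof.
elim: t => [|b t IHt] //=; rewrite big_cons; apply: ps_smallM => //.
case: eqP => //= <-; apply: ps_small1.
by rewrite rmorphB /= ps_res_const subrr.
Qed.

(** The order of vanishing of [f(x)] at [T = 0] is at least the number of
    roots with residue [x], and at most its degree in [T]. *)
Lemma count_residue_le {F : fieldType} {f : {poly {poly F}}} {c : powser F}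
    {t : seq (powser F)} {x : F} :
    map_poly (@ps_of_poly F) f = c *: \prod_(b <- t) ('X - b%:P) ->
    f.[x%:P] != 0 ->
  (count (fun b => ps_res b == x) t <= (sizeY f).-1)%N.
Proof.
move=> fE fx0.
have small_fx : ps_small (count (fun b => ps_res b == x) t)
    (ps_of_poly f.[x%:P]).
  rewrite -horner_map fE hornerZ horner_prod mulrC.
  under eq_bigr do rewrite hornerXsubC.
  exact/ps_smallMl/ps_small_prod.
have : lead_coef f.[x%:P] != 0 by rewrite lead_coef_eq0.
rewrite lead_coefE; set n := (size _).-1 => fn0.
apply: (@leq_trans n); last first.
  by rewrite /n -!subn1 leq_sub2r // max_size_evalC.
by rewrite leqNgt; apply: contraNN fn0 => /small_fx /= ->.
Qed.

Lemma size_le_residues {F : finFieldType} {f : {poly {poly F}}} {c : powser F}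
    {t : seq (powser F)} (D : {set F}) :
    map_poly (@ps_of_poly F) f = c *: \prod_(b <- t) ('X - b%:P) ->
    (forall x : F, f.[x%:P] != 0) -> all (fun b => ps_res b \in D) t ->
  (size t <= #|D| * (sizeY f).-1)%N.
Proof.
move=> fE fx0 tD; rewrite -sum_nat_const.
have -> : size t = (\sum_(x in D) count (fun b => ps_res b == x) t)%N.
  rewrite -sum1_size; under [RHS]eq_bigr do rewrite -sum1_count.
  rewrite (exchange_big_dep xpredT) //= big_seq [RHS]big_seq.
  apply: eq_bigr => b bt; rewrite (bigD1 (ps_res b)) /= ?(allP tD) ?eqxx //.
  rewrite big1 // => x /andP[/andP[_ /eqP->]].
  by rewrite eqxx.
by apply: leq_sum => x _; apply: count_residue_le fE (fx0 x).
Qed.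

(** The coefficients of the minimal polynomial have no denominators, so it
    lives over F[[T]], where residues make sense; its image over F((T)) is
    [minpoly_laurent]. *)
Definition minpoly_ps {F : fieldType} {L : closedFieldType}
    (iota : {rmorphism ratfun F -> L}) (alpha : L) : {poly powser F} :=
  map_poly (@ps_of_poly F) (minpoly iota alpha).

Section Height.
Context {F : fieldType} {L : closedFieldType}.
Context {iota : {rmorphism ratfun F -> L}}.
Hypothesis algL : forall x : L, algebraicOver iota x.
Implicit Types (alpha : L).

(** A constant root makes the irreducible [f] linear, with that constant as
    its only root. *)
Lemma minpoly_horner_const_neq0 {alpha} (x : F) :
  ~ is_constant iota alpha -> (minpoly iota alpha).[x%:P] != 0.
Proof.
move=> nc; apply: contra_not_neq nc => fx0.
have [[_ irr] root_alpha _ _] := minpolyP (algL alpha).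
set f := minpoly iota alpha in fx0 irr root_alpha.
have dvd : 'X - (tofrac x%:P)%:P %| map_poly tofrac f.
  by rewrite dvdp_XsubCl /root horner_map fx0 rmorph0.
have := irr _ _ dvd; rewrite size_XsubC => /(_ isT) eqf.
have : root (map_poly iota ('X - (tofrac x%:P)%:P)) alpha.
  rewrite (eqp_root (_ : _ %= map_poly iota (map_poly tofrac f))) ?eqp_map //.
  by rewrite -map_poly_comp.
rewrite rmorphB /= map_polyX map_polyC /= root_XsubC => /eqP->.
exact: algebraic_id.
Qed.

Lemma size_minpoly_gt1 alpha : (1 < size (minpoly iota alpha))%N.
Proof.
have [[irr1 _] _ _ _] := minpolyP (algL alpha).
exact: leq_trans irr1 (size_poly _ _).
Qed.

Lemma size_minpoly_ps alpha :
  size (minpoly_ps iota alpha) = size (minpoly iota alpha).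
Proof.
apply: size_map_inj_poly; last exact: rmorph0.
by move=> x y /powserP xy; apply/polyP.
Qed.

Lemma minpoly_laurentE alpha :
  minpoly_laurent iota alpha = map_poly tofrac (minpoly_ps iota alpha).
Proof. by rewrite -map_poly_comp. Qed.

Lemma conjugates_tofrac alpha b :
  conjugates iota alpha (tofrac b) <-> root (minpoly_ps iota alpha) b.
Proof.
by rewrite /conjugates /= minpoly_laurentE /root horner_map tofrac_eq0.
Qed.

(** For an element of the ring R_q the roots over F((T)) are integral, so the
    splitting descends to F[[T]]. *)
Lemma calR_split {alpha} : calR iota alpha ->
  exists t : seq (powser F), minpoly_ps iota alpha =
    lead_coef (minpoly_ps iota alpha) *: \prod_(b <- t) ('X - b%:P).
Proof.
case=> -[s splitL] int_conj.
have leadE : lead_coef (minpoly_laurent iota alpha) =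
    tofrac (lead_coef (minpoly_ps iota alpha)).
  by rewrite minpoly_laurentE lead_coef_map_inj ?rmorph0 //; apply: tofrac_inj.
have f0 : lead_coef (minpoly_laurent iota alpha) != 0.
  rewrite leadE tofrac_eq0 lead_coef_eq0 -size_poly_gt0 size_minpoly_ps.
  exact: ltnW (size_minpoly_gt1 alpha).
have s_int b : b \in s -> exists c, b = tofrac c.
  move=> bs; apply: ord0_ge0; apply: int_conj; rewrite /conjugates /= splitL.
  by rewrite rootZ // root_prod_XsubC.
have [t ts] : exists t : seq (powser F), s = map tofrac t.
  elim: (s) s_int => [|x r IHr] r_int; first by exists [::].
  have [b ->] := r_int x (mem_head x r).
  have [y yr|t ->] := IHr; first by apply: r_int; rewrite inE yr orbT.
  by exists (b :: t).
exists t; apply: (map_inj_poly (@tofrac_inj _)); first exact: rmorph0.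
rewrite -minpoly_laurentE splitL leadE map_polyZ rmorph_prod /= ts big_map.
by under [in RHS]eq_bigr do rewrite rmorphB /= map_polyX map_polyC.
Qed.
End Height.

(** Stated for an arbitrary set [D] of allowed residues, to cover both the
    ring, where [D] is the whole field, and its units, where [0] is excluded. *)
Lemma height_ge {F : finFieldType} {L : closedFieldType}
    {iota : {rmorphism ratfun F -> L}} {alpha : L} (D : {set F}) :
    (forall x : L, algebraicOver iota x) ->
    calR iota alpha -> ~ is_constant iota alpha ->
    (forall b, conjugates iota alpha (tofrac b) -> ps_res b \in D) ->
  1 / #|D|%:R <= height iota alpha.
Proof.
move=> algL Ralpha nc conjD.
have [t split_t] := calR_split algL Ralpha.
have lc0 : lead_coef (minpoly_ps iota alpha) != 0.
  rewrite lead_coef_eq0 -size_poly_gt0 size_minpoly_ps.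
  exact: ltnW (size_minpoly_gt1 algL alpha).
have size_t : size (minpoly iota alpha) = (size t).+1.
  rewrite -size_minpoly_ps split_t size_scale //.
  exact: (size_prod_XsubC t id).
have t_gt0 : (0 < size t)%N by rewrite -ltnS -size_t size_minpoly_gt1.
have tD : all (fun b => ps_res b \in D) t.
  apply/allP => b bt; apply: conjD; apply/conjugates_tofrac.
  by rewrite split_t rootZ // root_prod_XsubC.
have := size_le_residues D split_t
  (fun x => minpoly_horner_const_neq0 algL x nc) tD.
rewrite /height size_t /=; set h := (_.-1)%N => le_t.
have D_gt0 : (0 < #|D|)%N.
  by rewrite lt0n; apply: contraTneq le_t => ->; rewrite mul0n -ltnNge.
rewrite ler_pdivrMr ?ltr0n // mulrAC ler_pdivlMr ?ltr0n //.
by rewrite mul1r -natrM ler_nat mulnC.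
Qed.

(** * Elements of minimal height *)

(** The equation [T = A(x)]: as a polynomial in [T] over F[x] it is linear with
    root [A], which is what makes it irreducible. *)
Definition graph_poly {F : fieldType} (A : {poly F}) : {poly {poly F}} :=
  map_poly polyC A - 'X%:P.

Section GraphPoly.
Context {F : fieldType} {A : {poly F}}.
Hypotheses (monA : A \is monic) (sizeA : (1 < size A)%N).

Lemma swapXY_graph : swapXY (graph_poly A) = - ('X - A%:P).
Proof. by rewrite rmorphB /= swapXY_map_polyC swapXY_Y opprB. Qed.

Lemma sizeY_graph : sizeY (graph_poly A) = 2.
Proof. by rewrite sizeYE swapXY_graph size_polyN size_XsubC. Qed.

Lemma size_tail_lt :
  (size (- 'X%:P : {poly {poly F}}) < size (map_poly polyC A))%N.
Proof.
rewrite size_polyN size_map_polyC; apply: leq_ltn_trans sizeA.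
exact: size_polyC_leq1.
Qed.

Lemma size_graph : size (graph_poly A) = size A.
Proof. by rewrite size_polyDl ?size_tail_lt // size_map_polyC. Qed.

Lemma graph_monic : graph_poly A \is monic.
Proof.
rewrite monicE lead_coefDl ?size_tail_lt // lead_coef_map_inj //.
  by rewrite (monicP monA).
exact: polyC_inj.
Qed.

Context {L : closedFieldType} {iota : {rmorphism ratfun F -> L}}.
Hypothesis algL : forall x : L, algebraicOver iota x.
Context {alpha : L}.
Hypothesis root_alpha :
  root (map_poly (iota \o @FracField.tofrac {poly F}) (graph_poly A)) alpha.

Local Notation toL := (iota \o @FracField.tofrac {poly F} \o @polyC F).

Lemma iotaX : iota (tofrac 'X) = (map_poly toL A).[alpha].
Proof.
have := root_alpha; rewrite /root /graph_poly rmorphB /= map_polyC /=.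
rewrite hornerD hornerN hornerC subr_eq0 => /eqP <-.
by rewrite -map_poly_comp.
Qed.

Lemma iota_poly (p : {poly F}) :
  iota (tofrac p) = (map_poly toL p).[iota (tofrac 'X)].
Proof.
rewrite -[in LHS](comp_polyXr p) /comp_poly -!horner_map /= -!map_poly_comp.
by [].
Qed.

Lemma iotaX_transcendental (p : {poly F}) :
  (map_poly toL p).[iota (tofrac 'X)] = 0 -> p = 0.
Proof.
by rewrite -iota_poly => /eqP; rewrite fmorph_eq0 tofrac_eq0 => /eqP.
Qed.

(** If [alpha] were algebraic over F, so would be [A(alpha) = T]. *)
Lemma graph_root_nonconstant : ~ is_constant iota alpha.
Proof.
move=> /integral_algebraic const_alpha.
have /integral_algebraic[p p0 /rootP] : integralOver toL (iota (tofrac 'X)).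
  rewrite iotaX; apply: integral_horner => // x /(nthP 0)[i _ <-].
  rewrite coef_map; exact: integral_id.
by move/iotaX_transcendental/eqP; rewrite (negbTE p0).
Qed.

Lemma transcendental_root (p : {poly F}) :
  (map_poly toL p).[alpha] = 0 -> p = 0.
Proof.
move=> pa; apply/eqP/contraT => p0; case: graph_root_nonconstant.
by exists p => //; apply/rootP.
Qed.

(** As [alpha] is transcendental over F and [T = A(alpha)], the relation
    [g(T, alpha) = 0] is the polynomial identity [g(A(x), x) = 0].  So [A] is a
    root of [g] viewed as a polynomial in [T], and the factor theorem
    applies over F[x]. *)
Lemma graph_dvd (g : {poly {poly F}}) :
  root (map_poly (iota \o @FracField.tofrac {poly F}) g) alpha ->
  exists h, g = h * graph_poly A.
Proof.
move=> ga.
have /factor_theorem[h gE] : root (swapXY g) A.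
  apply/eqP/transcendental_root.
  rewrite -horner_map -[swapXY g]/(swapXY g) /= -swapXY_map /= horner2_outer.
  rewrite -iotaX horner2_swapXY -[LHS]/(horner_eval _ _) -horner_map /=.
  rewrite {2}/horner_eval hornerC -map_poly_comp -[RHS](rootP ga).
  by congr _.[_]; apply: eq_map_poly => p; symmetry; apply: iota_poly.
exists (- swapXY h); rewrite -[g]swapXYK gE rmorphM mulNr -mulrN /=.
by rewrite -[graph_poly A]swapXYK swapXY_graph rmorphN opprK.
Qed.

(** The irreducible minimal polynomial is a multiple of [graph_poly A], hence
    associated to it over F(T); both are primitive with monic leading
    coefficient, hence equal. *)
Lemma graph_is_minpoly : minpoly iota alpha = graph_poly A.
Proof.
have minm := minpolyP (algL alpha); have [irr rm _ _] := minm.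
have [h mE] := graph_dvd _ rm.
have eqm :
    map_poly tofrac (graph_poly A) %= map_poly tofrac (minpoly iota alpha).
  apply: irr.2; last by rewrite mE rmorphM /= dvdp_mull.
  rewrite size_map_inj_poly ?rmorph0 ?size_graph ?gtn_eqF //.
  exact: tofrac_inj.
apply: is_minpoly_uniq minm _; split => //.
- split; first by rewrite (eqp_size eqm) irr.1.
  move=> r sr; rewrite (eqp_dvdr _ eqm) => /(irr.2 _ sr) eqr.
  by rewrite (eqp_trans eqr) // eqp_sym.
- move=> d /(_ (size (graph_poly A)).-1).
  by rewrite -lead_coefE (monicP graph_monic) dvdp1 size_poly_eq1.
- by rewrite (monicP graph_monic) monic1.
Qed.
End GraphPoly.

(** The witness is a root of [A(x) - T], with [A] the product of the [X - a]
    for [a] in [s]: its conjugates are the Hensel lifts of the elements of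
    [s], one for each. *)
Lemma height_attained {F : fieldType} {L : closedFieldType}
    {iota : {rmorphism ratfun F -> L}} (s : seq F) :
    (forall x : L, algebraicOver iota x) -> uniq s -> (0 < size s)%N ->
  exists alpha : L,
    [/\ totally_Tadic iota alpha,
        forall x, conjugates iota alpha x ->
          exists2 b, x = tofrac b & ps_res b \in s,
        ~ is_constant iota alpha
      & height iota alpha = 1 / (size s)%:R].
Proof.
move=> algL us s_gt0; pose A := \prod_(x <- s) ('X - x%:P).
have monA : A \is monic by exact: monic_prod_XsubC.
have sizeA : size A = (size s).+1 by exact: (size_prod_XsubC s id).
have A_gt1 : (1 < size A)%N by rewrite sizeA.
set f := graph_poly A.
have [alpha root_alpha] :
    exists alpha, root (map_poly (iota \o @FracField.tofrac {poly F}) f) alpha.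
  apply/closed_rootP.
  rewrite size_map_inj_poly ?rmorph0 ?size_graph ?gtn_eqF //.
  exact: inj_comp (fmorph_inj iota) (@tofrac_inj _).
have minE := graph_is_minpoly monA A_gt1 algL root_alpha.
have [t tE ts] : exists2 t, map_poly (@ps_of_poly F) f =
    \prod_(b <- t) ('X - b%:P) & map (@ps_res F) t = s.
  apply: hensel_split us; first exact/monic_map/graph_monic.
  rewrite -map_poly_comp rmorphB /= map_polyC /= -map_poly_comp.
  rewrite [ps_res _]coefX subr0 map_poly_id // => x _.
  exact: ps_res_const.
have laurentE : minpoly_laurent iota alpha =
    \prod_(x <- map tofrac t) ('X - x%:P).
  rewrite minpoly_laurentE /minpoly_ps minE tE rmorph_prod big_map /=.
  by apply: eq_bigr => b _; rewrite rmorphB /= map_polyX map_polyC.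
exists alpha; split.
- exists (map tofrac t); rewrite laurentE.
  by rewrite (monicP (monic_prod_XsubC _ _ _)) scale1r.
- move=> x; rewrite /conjugates /= laurentE root_prod_XsubC => /mapP[b bt ->].
  by exists b => //; rewrite -ts map_f.
- exact: graph_root_nonconstant root_alpha.
- by rewrite /height minE sizeY_graph size_graph // sizeA.
Qed.

Theorem theoremD (q : nat) (F : finFieldType) (cardF : #|F| = q)
    (L : closedFieldType) (iota : {rmorphism ratfun F -> L})
    (algL : forall x : L, algebraicOver iota x) :
  [/\ forall alpha : L, calR iota alpha -> ~ is_constant iota alpha ->
        1 / q%:R <= height iota alpha,
      forall alpha : L, calR_units iota alpha -> ~ is_constant iota alpha ->
        1 / (q%:R - 1) <= height iota alpha,
      exists alpha : L, [/\ calR iota alpha, ~ is_constant iota alpha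
        & height iota alpha = 1 / q%:R]
    & exists alpha : L, [/\ calR_units iota alpha, ~ is_constant iota alpha
        & height iota alpha = 1 / (q%:R - 1)]].
Proof.
have card_units : #|[set~ (0 : F)]| = q.-1 by rewrite cardsC1 cardF.
have q_gt1 : (1 < q)%N by rewrite -cardF finNzRing_gt1.
have predq : q.-1%:R = q%:R - 1 :> rat by rewrite -subn1 natrB ?(ltnW q_gt1).
split.
- move=> alpha Ralpha nc; rewrite -cardF -cardsT.
  by apply: (height_ge _ algL Ralpha nc) => b _; rewrite inE.
- move=> alpha [Talpha unit_conj] nc; rewrite -predq -card_units.
  apply: (height_ge _ algL _ nc) => [|b /unit_conj/ord0_tofrac_eq0 b0].
    by split=> // x /unit_conj ->.
  by rewrite !inE.
- have [||alpha [Talpha conj nc hE]] := height_attained (enum F) algL.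
  + exact: enum_uniq.
  + by rewrite -cardE cardF ltnW.
  exists alpha; rewrite hE -cardE cardF; split=> //; split=> // x /conj[b -> _].
  exact: ord0_tofrac_ge0.
have [||alpha [Talpha conj nc hE]] :=
  height_attained (enum [set~ (0 : F)]) algL.
- exact: enum_uniq.
- by rewrite -cardE card_units -subn1 subn_gt0.
exists alpha; rewrite hE -cardE card_units predq; split=> //.
split=> // x /conj[b -> b0]; apply/ord0_tofrac_eq0.
by rewrite mem_enum !inE in b0.
Qed.
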